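(* Let $u$ be the solution of the variational problem (VP) and assume that $u\in H^{r}(\Omega)$ for all $r\in\mathbb{N}$. Let $k$ be a fixed integer with $k>\frac{n}{2}$. For $q\in\mathbb{N}^{\star}=\{1,2,\dots\}$ let $$h^*_q=\left(\frac{\mathscr{C}^*_k\,|u|_{k+1,\Omega}}{\mathscr{C}^*_{k+q}\,|u|_{k+q+1,\Omega}}\right)^{\frac1q},$$ and let $\mathcal{P}_q$ be the function of $h>0$ given by $$\mathcal{P}_q(h)=\begin{cases}1-\dfrac12\left(\dfrac{h}{h^*_q}\right)^{q} & \text{if } 0<\dfrac{h}{h^*_q}\le 1,\\[2mm] \dfrac12\left(\dfrac{h^*_q}{h}\right)^{q} & \text{if } \dfrac{h}{h^*_q}\ge 1.\end{cases}$$ If $$\lim_{q\to+\infty}\frac{|u|_{k+q+2,\Omega}}{|u|_{k+q+1,\Omega}}=l\quad\text{for some } l\in\mathbb{R},\ l>0,$$ then $$h^*_q\underset{q\to+\infty}{\sim}\frac{1}{e\,l}\,q\qquad\text{and}\qquad \lim_{q\to+\infty}h^*_q=+\infty.$$ Moreover, the sequence of functions $(\mathcal{P}_q)_{q\in\mathbb{N}^\star}$ converges pointwise on $\mathbb{R}^*_+=\,]0,+\infty[$, as $q\to+\infty$, to the function $\mathcal{P}_0$ given by $$\mathcal{P}_0(h)=\begin{cases}1 & \text{if } 0\le h<+\infty,\\ \frac12 & \text{if } h=+\infty.\end{cases}$$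
   Context: $\Omega\subset\mathbb{R}^n$ is a nonempty bounded open set whose boundary is piecewise $C^1$. $V=H^1(\Omega)$, $a(\cdot,\cdot)$ is a bilinear, continuous and $V$-elliptic form on $V\times V$ with continuity constant $M$ and ellipticity constant $\alpha$, and $l(\cdot)$ is a continuous linear form on $V$ (not to be confused with the real number $l$ in the claim). Problem (VP) is: find $u\in V$ such that $a(u,v)=l(v)$ for all $v\in V$; it has a unique solution $u$. $|\cdot|_{r,\Omega}$ denotes the usual semi-norm of $H^r(\Omega)$. $\Omega$ is exactly covered by a regular mesh $\mathcal{T}_h$ of $n$-simplexes; $h_K$ is the diameter of $K$, $\rho_K$ is the supremum of the diameters of the spheres inscribed in $K$, and $\sigma\ge1$ is a number such that $h_K/\rho_K\le\sigma$ for all $K\in\mathcal{T}_h$. $\Lambda$ denotes the maximum of the absolute values of the (constant) partial derivatives $\partial\lambda_l/\partial x^j$, $1\le j\le n$, $1\le l\le n+1$, of the barycentric coordinates; it does not depend on the polynomial degree. For an integer $k>\frac n2$, $$\mathscr{C}^*_k=\frac{M\,C(\bar\Omega,\sigma,\Lambda,n)}{\alpha}\,\frac{(k+n)^n k^{n+2}}{(k-1)!\left(k-\frac n2\right)},\qquad C(\bar\Omega,\sigma,\Lambda,n)=1+2\,\mathrm{diam}(\bar\Omega)+\sigma n(n+1)\Lambda .$$ The prefactor $M\,C(\bar\Omega,\sigma,\Lambda,n)/\alpha$ is a positive constant independent of the polynomial degree. Interpretation: $\mathcal{P}_q(h)$ is the probability $\mathrm{Prob}\{X^{(k+q)}(h)\le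 X^{(k)}(h)\}$, where, for $i\in\{k,k+q\}$, $X^{(i)}(h)$ (modelling the $H^1$-error of the $P_i$ Lagrange finite element approximation of $u$) are independent and uniformly distributed on $[0,\mathscr{C}^*_i|u|_{i+1,\Omega}h^i]$. $a_q\underset{q\to+\infty}{\sim}b_q$ means $a_q/b_q\to1$. *)

(* Defs.v *)
From HB Require Import structures.
From mathcomp Require Import all_boot all_order all_algebra.
From mathcomp Require Import all_classical all_reals all_analysis.

Set Implicit Arguments.
Unset Strict Implicit.
Unset Printing Implicit Defensive.

Import Order.TTheory GRing.Theory Num.Theory.
Import numFieldNormedType.Exports.

Local Open Scope classical_set_scope.
Local Open Scope ring_scope.

(* R^n is 'rV[R]_n: its topology is the library's (the sup norm generates the
   usual topology); the Euclidean norm, needed for diameters, is [enorm]. *)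

Definition rV_display : measure_display. Proof. exact. Qed.

Section measurable_rV.
Variables (R : realType) (n : nat).

Let coor : 'I_n -> 'rV[R]_n -> measurableTypeR R := fun i x => x ord0 i.

Let rV_set0 : g_sigma_preimage coor set0.
Proof. exact: sigma_algebra0. Qed.

Let rV_setC A : g_sigma_preimage coor A -> g_sigma_preimage coor (~` A).
Proof. exact: sigma_algebraC. Qed.

Let rV_bigcup (F : (set 'rV[R]_n)^nat) :
  (forall i, g_sigma_preimage coor (F i)) ->
  g_sigma_preimage coor (\bigcup_i F i).
Proof. exact: sigma_algebra_bigcup. Qed.

(* Product sigma-algebra, i.e. the Borel sigma-algebra of R^n. *)
HB.instance Definition _ := @isMeasurable.Build rV_display
  'rV[R]_n (g_sigma_preimage coor) rV_set0 rV_setC rV_bigcup.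

End measurable_rV.

Section cons_rV.
Variables (R : realType) (n : nat).

Definition cons_rV (p : measurableTypeR R * 'rV[R]_n) : 'rV[R]_n.+1 :=
  row_mx (p.1 : R)%:M p.2.

Definition uncons_rV (x : 'rV[R]_n.+1) : measurableTypeR R * 'rV[R]_n :=
  (x ord0 ord0, \row_j x ord0 (lift ord0 j)).

Lemma cons_rV0 p : cons_rV p ord0 ord0 = p.1.
Proof.
rewrite /cons_rV (_ : ord0 = lshift n (ord0 : 'I_1)); last exact/val_inj.
by rewrite (@row_mxEl _ 1 1 n) mxE eqxx mulr1n.
Qed.

Lemma cons_rVS p j : cons_rV p ord0 (lift ord0 j) = p.2 ord0 j.
Proof.
rewrite /cons_rV (_ : lift ord0 j = rshift 1 j); last exact/val_inj.
exact: (@row_mxEr _ 1 1 n).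
Qed.

Lemma cons_rVK : cancel cons_rV uncons_rV.
Proof.
case=> x v; rewrite /uncons_rV cons_rV0; congr pair.
by apply/rowP => j; rewrite mxE cons_rVS.
Qed.

End cons_rV.

Lemma measurable_coor_rV (R : realType) n (i : 'I_n) :
  measurable_fun [set: 'rV[R]_n]
    (fun x : 'rV[R]_n => x ord0 i : measurableTypeR R).
Proof.
move=> _ Y mY; rewrite setTI; apply: sub_sigma_algebra => /=.
rewrite -bigcup_seq/=; exists i => /=; first by rewrite mem_index_enum.
by exists Y => //; rewrite setTI.
Qed.

Lemma measurable_fun_rVP (R : realType) n d (T : measurableType d)
    (f : T -> 'rV[R]_n) :
  (forall i, measurable_fun setT (fun x => f x ord0 i : measurableTypeR R)) ->
  measurable_fun setT f.
Proof.
move=> mf _ A mA; rewrite setTI.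
pose S := [set B : set 'rV[R]_n | measurable (f @^-1` B)].
suff : S A by [].
move: A mA; apply: smallest_sub.
  split.
  - by rewrite /S/= preimage_set0.
  - by move=> B; rewrite /S/= setTD preimage_setC => /measurableC.
  - by move=> F mF; rewrite /S/= preimage_bigcup; apply: bigcupT_measurable.
move=> B; rewrite -bigcup_seq => -[i _ [Y mY <-]].
by rewrite /S/= setTI; have := mf i measurableT Y mY; rewrite setTI.
Qed.

Lemma measurable_cons_rV (R : realType) n : measurable_fun setT (@cons_rV R n).
Proof.
apply: measurable_fun_rVP => i; case: (unliftP ord0 i) => [j|] ->.
  rewrite (_ : (fun _ => _) =
    (fun v : 'rV[R]_n => v ord0 j : measurableTypeR R) \o snd).
    apply: measurableT_comp; [exact: measurable_coor_rV|exact: measurable_snd].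
  by apply/funext => p; rewrite cons_rVS.
rewrite (_ : (fun _ => _) = fst); first exact: measurable_fst.
by apply/funext => p; rewrite cons_rV0.
Qed.

Lemma measurable_uncons_rV (R : realType) n :
  measurable_fun setT (@uncons_rV R n).
Proof.
apply: measurable_fun_pair; first exact: measurable_coor_rV.
apply: measurable_fun_rVP => i.
rewrite (_ : (fun _ => _) =
  fun x : 'rV[R]_n.+1 => x ord0 (lift ord0 i) : measurableTypeR R).
  exact: measurable_coor_rV.
by apply/funext => x; rewrite mxE.
Qed.

Section lebesgue_rV_step.
Variables (R : realType) (n : nat).
Variable m : {sigma_finite_measure set 'rV[R]_n -> \bar R}.
Local Open Scope ereal_scope.

Definition lebesgue_rV_step : set 'rV[R]_n.+1 -> \bar R :=
  pushforward (@lebesgue_measure R \x m) (@cons_rV R n).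

Let step0 : lebesgue_rV_step set0 = 0.
Proof. by rewrite /lebesgue_rV_step /pushforward preimage_set0 measure0. Qed.

Let step_ge0 A : 0 <= lebesgue_rV_step A.
Proof. exact: (@measure_ge0 _ _ _ (@lebesgue_measure R \x m)). Qed.

Let step_sigma_additive : semi_sigma_additive lebesgue_rV_step.
Proof.
move=> F mF tF mUF; rewrite /lebesgue_rV_step /pushforward preimage_bigcup.
have mp A : measurable A -> measurable (@cons_rV R n @^-1` A).
  by move=> mA; have := @measurable_cons_rV R n measurableT A mA; rewrite setTI.
apply: measure_semi_sigma_additive.
- by move=> i; exact: mp.
- apply/trivIsetP => /= i j _ _ ij; rewrite -preimage_setI.
  by move/trivIsetP : tF => /(_ i j Logic.I Logic.I ij) ->; rewrite preimage_set0.
- by rewrite -preimage_bigcup; exact: mp.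
Qed.

HB.instance Definition _ := isMeasure.Build _ _ _
  lebesgue_rV_step step0 step_ge0 step_sigma_additive.

Let step_sigma_finite : sigma_finite setT lebesgue_rV_step.
Proof.
have /sigma_finiteP[F [TF ndF Foo]] := sigma_finiteT (@lebesgue_measure R).
have /sigma_finiteP[G [TG ndG Goo]] := sigma_finiteT m.
exists (fun i => @uncons_rV R n @^-1` (F i `*` G i)).
  rewrite -preimage_bigcup (_ : \bigcup_i _ = setT) ?preimage_setT//.
  rewrite -setXTT TF TG predeqE => -[x y]; split.
    by move=> [i _ []/= ? ?]; split; exists i.
  move=> [/= [i _ Fx] [j _ Gy]]; exists (maxn i j) => //; split.
  - by move: x Fx; exact/subsetPset/ndF/leq_maxl.
  - by move: y Gy; exact/subsetPset/ndG/leq_maxr.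
move=> i; have [mF ?] := Foo i; have [mG ?] := Goo i; split.
  have := @measurable_uncons_rV R n measurableT _ (measurableX mF mG).
  by rewrite setTI.
rewrite /lebesgue_rV_step /pushforward -comp_preimage.
rewrite (_ : uncons_rV (n:=n) \o cons_rV (n:=n) = id); last first.
  by apply/funext => p; exact: cons_rVK.
by rewrite preimage_id product_measure1E// lte_mul_pinfty// ge0_fin_numE.
Qed.

HB.instance Definition _ := Measure_isSigmaFinite.Build _ _ _
  lebesgue_rV_step step_sigma_finite.

End lebesgue_rV_step.

Fixpoint lebesgue_rV (R : realType) (n : nat) :
    {sigma_finite_measure set 'rV[R]_n -> \bar R} :=
  match n with
  | 0 => \d_ (0 : 'rV[R]_0)
  | n'.+1 => lebesgue_rV_step (lebesgue_rV R n')
  end.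

Section sobolev.
Variables (R : realType) (n : nat).
Implicit Types (u v g phi : 'rV[R]_n -> R) (alpha : 'I_n -> nat).

Definition partial (i : 'I_n) phi : 'rV[R]_n -> R :=
  fun x => 'D_(delta_mx 0 i) phi x.

Definition multi_order alpha : nat := (\sum_(i < n) alpha i)%N.

Definition multi_partial alpha phi : 'rV[R]_n -> R :=
  foldr (fun i f => iter (alpha i) (partial i) f) phi (enum 'I_n).

Definition smooth phi : Prop :=
  forall s : seq 'I_n, let f := foldr partial phi s in
    continuous f /\ forall i x, derivable f x (delta_mx 0 i).

Variable Omega : set 'rV[R]_n.
Local Notation leb := (lebesgue_rV R n).

Definition test_function phi : Prop :=
  smooth phi /\
  exists K, [/\ compact K, K `<=` Omega & forall x, ~ K x -> phi x = 0].

(* Elements of function spaces on Omega are represented by functions on R^n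
   whose values outside Omega are irrelevant. *)
Definition L2 u : Prop :=
  measurable_fun Omega u /\
  leb.-integrable Omega (fun x => (u x ^+ 2)%:E).

Definition is_weak_derivative alpha u g : Prop :=
  forall phi, test_function phi ->
    \int[leb]_(x in Omega) (u x * multi_partial alpha phi x) =
    (-1) ^+ multi_order alpha * \int[leb]_(x in Omega) (g x * phi x).

Definition sobolev (m : nat) : set ('rV[R]_n -> R) :=
  [set u | L2 u /\
    forall alpha, (multi_order alpha <= m)%N ->
      exists g, L2 g /\ is_weak_derivative alpha u g].

(* A weak derivative in L^2 is unique up to a null set, so the integrals below
   do not depend on the choice made here. *)
Definition weak_derivative alpha u : 'rV[R]_n -> R :=
  xget (fun=> 0) [set g | L2 g /\ is_weak_derivative alpha u g].

Definition sobolev_seminorm (r : nat) u : R :=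
  Num.sqrt (\sum_(alpha : {ffun 'I_n -> 'I_r.+1} |
                  multi_order (fun i => alpha i) == r)
    \int[leb]_(x in Omega) (weak_derivative (fun i => alpha i) u x ^+ 2)).

Definition sobolev_norm (m : nat) u : R :=
  Num.sqrt (\sum_(r < m.+1) sobolev_seminorm r u ^+ 2).

End sobolev.

Section forms.
Variables (R : realType) (n : nat) (Omega : set 'rV[R]_n).
Local Notation V := (sobolev Omega 1).
Local Notation normV := (sobolev_norm Omega 1).
Local Notation funT := ('rV[R]_n -> R).

(* Forms are defined on representatives.  A linear (resp. bilinear) form that
   is continuous for the H^1 norm takes equal values on functions that agree
   almost everywhere in Omega, hence is a form on H^1(Omega). *)
Definition linear_form (ell : funT -> R) : Prop :=
  forall (c : R) (v w : funT), V v -> V w ->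
    ell (fun x => c * v x + w x) = c * ell v + ell w.

Definition bilinear_form (a : funT -> funT -> R) : Prop :=
  (forall v, V v -> linear_form (a v)) /\
  (forall v, V v -> linear_form (a ^~ v)).

Definition continuous_linear_form (ell : funT -> R) : Prop :=
  exists C : R, forall v, V v -> `|ell v| <= C * normV v.

Definition continuous_bilinear_form (M : R) (a : funT -> funT -> R) : Prop :=
  0 < M /\
  forall v w, V v -> V w -> `|a v w| <= M * normV v * normV w.

Definition elliptic_form (alpha : R) (a : funT -> funT -> R) : Prop :=
  0 < alpha /\ forall v, V v -> alpha * normV v ^+ 2 <= a v v.

Definition solves_VP (a : funT -> funT -> R) (ell : funT -> R) (u : funT) :=
  V u /\ forall v, V v -> a u v = ell v.

End forms.

Section boundary.
Variables (R : realType).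

Definition C1_on m n (U : set 'rV[R]_m) (phi : 'rV[R]_m -> 'rV[R]_n) : Prop :=
  forall x, U x ->
    differentiable phi x /\ {for x, continuous (fun y => jacobian phi y)}.

Definition closed_cube m : set 'rV[R]_m :=
  [set x | forall i, 0 <= x 0 i <= 1].
Definition open_cube m : set 'rV[R]_m :=
  [set x | forall i, 0 < x 0 i < 1].

(* phi maps the closed unit cube of R^(n-1) onto a C^1 hypersurface patch: it
   is injective on the cube and extends to a C^1 immersion of a neighbourhood. *)
Definition C1_patch n (phi : 'rV[R]_n.-1 -> 'rV[R]_n) : Prop :=
  (exists U, [/\ open U, @closed_cube n.-1 `<=` U, C1_on U phi &
     forall x, U x -> row_free (jacobian phi x)]) /\
  set_inj (@closed_cube n.-1) phi.

(* The last clause says that patches overlap at most along their edges. *)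
Definition piecewise_C1_boundary n (Omega : set 'rV[R]_n) : Prop :=
  exists (p : nat) (phi : 'I_p -> 'rV[R]_n.-1 -> 'rV[R]_n),
    [/\ forall i, C1_patch (phi i),
        closure Omega `\` Omega° =
          \bigcup_(i in [set: 'I_p]) (phi i @` @closed_cube n.-1) &
        forall i j, i != j ->
          phi i @` @open_cube n.-1 `&` phi j @` @open_cube n.-1 = set0].

End boundary.

Section mesh.
Variables (R : realType) (n : nat).

Definition enorm (x : 'rV[R]_n) : R := Num.sqrt (\sum_(i < n) x 0 i ^+ 2).

Definition diam (A : set 'rV[R]_n) : R :=
  sup [set d | exists x y, [/\ A x, A y & d = enorm (x - y)]].

Definition inscribed_diam (K : set 'rV[R]_n) : R :=
  sup [set d | exists c (r : R),
    [/\ 0 <= r, [set x | enorm (x - c) <= r] `<=` K & d = 2 * r]].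

(* An n-simplex is given by the matrix whose n+1 rows are its vertices. *)
Implicit Type A : 'M[R]_(n.+1, n).

Definition vertices1 A : 'M[R]_n.+1 := row_mx (const_mx 1 : 'cV_n.+1) A.

Definition nondegenerate A : bool := vertices1 A \in unitmx.

(* The solution lambda of
   \sum_l lambda_l = 1, \sum_l lambda_l *: row l A = x. *)
Definition barycentric A (x : 'rV[R]_n) : 'rV[R]_n.+1 :=
  row_mx (1%:M : 'rV_1) x *m invmx (vertices1 A).

Definition face A (S : {set 'I_n.+1}) : set 'rV[R]_n :=
  [set x | exists lambda : 'rV[R]_n.+1,
    [/\ forall l, 0 <= lambda 0 l, forall l, l \notin S -> lambda 0 l = 0,
        \sum_l lambda 0 l = 1 & x = lambda *m A]].

Definition simplex A : set 'rV[R]_n := face A [set: 'I_n.+1]%SET.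

(* The last clause is conformity: two distinct simplexes meet along a common
   proper face, which may be empty (S = set0). *)
Definition simplicial_mesh (Omega : set 'rV[R]_n) (N : nat)
    (T : 'I_N -> 'M[R]_(n.+1, n)) : Prop :=
  [/\ forall i, nondegenerate (T i),
      closure Omega = \bigcup_(i in [set: 'I_N]) simplex (T i) &
      forall i j, i != j -> exists S S' : {set 'I_n.+1},
        [/\ S != [set: 'I_n.+1]%SET, S' != [set: 'I_n.+1]%SET,
            simplex (T i) `&` simplex (T j) = face (T i) S &
            simplex (T i) `&` simplex (T j) = face (T j) S']].

Definition regular_mesh (sigma : R) (N : nat)
    (T : 'I_N -> 'M[R]_(n.+1, n)) : Prop :=
  forall i, diam (simplex (T i)) / inscribed_diam (simplex (T i)) <= sigma.

(* Barycentric coordinates are affine, so their partial derivatives may be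
   evaluated at any point, here 0. *)
Definition mesh_Lambda (N : nat) (T : 'I_N -> 'M[R]_(n.+1, n)) : R :=
  \big[Num.max/0]_(K < N) \big[Num.max/0]_(l < n.+1) \big[Num.max/0]_(j < n)
    `| partial j (fun x => barycentric (T K) x 0 l) 0 |.

End mesh.

Section probabilities.
Variables (R : realType) (n : nat).

Definition C_geom (Omega : set 'rV[R]_n) (sigma Lambda : R) : R :=
  1 + 2 * diam (closure Omega) + sigma * n%:R * n.+1%:R * Lambda.

Definition C_star (M alpha C : R) (k : nat) : R :=
  M * C / alpha *
  ((k + n)%:R ^+ n * k%:R ^+ n.+2 / (k.-1`!%:R * (k%:R - n%:R / 2))).

Definition h_star (Omega : set 'rV[R]_n) (u : 'rV[R]_n -> R)
    (M alpha C : R) (k q : nat) : R :=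
  ((C_star M alpha C k * sobolev_seminorm Omega (k + 1) u) /
   (C_star M alpha C (k + q) * sobolev_seminorm Omega (k + q + 1) u))
    `^ (q%:R^-1).

Definition P_fun (hs : R) (q : nat) (h : R) : R :=
  if h / hs <= 1 then 1 - 2^-1 * (h / hs) ^+ q else 2^-1 * (hs / h) ^+ q.

Definition P_zero (h : \bar R) : R := if h == +oo%E then 2^-1 else 1.

End probabilities.

(* Main.v *)
Require Import Defs.
From mathcomp Require Import all_boot all_order all_algebra.
From mathcomp Require Import all_classical all_reals all_analysis.
From mathcomp Require Import measurable_realfun ring lra.

Import Order.TTheory GRing.Theory Num.Theory.
Import numFieldNormedType.Exports.

Local Open Scope classical_set_scope.
Local Open Scope ring_scope.

Set Implicit Arguments.
Unset Strict Implicit.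
Unset Printing Implicit Defensive.

(** Write X_q for the q-th power of h*_q.  Since (k + q - 1)! stands in the
    denominator of C*_(k+q), X_q behaves like a factorial divided by a power of
    l: the ratio X_(q+1) / X_q is equivalent to (q + 1) / l, because the
    rational factors of C*_(k+q) / C*_(k+q+1) tend to 1 and the seminorms
    contribute 1 / l in the limit.  Hence Y_q = X_q (e l / q)^q has a ratio of
    consecutive terms tending to 1, the factor e being absorbed by
    (q / (q + 1))^q -> 1 / e, and passing from ratios to roots
    ([cvg_root_of_ratio]) gives h*_q ~ q / (e l) ([h_star_asymptotics]).  So
    h*_q tends to infinity; for a fixed h the quotient h / h*_q is eventually at
    most 1/2, and P_q(h) = 1 - (h / h*_q)^q / 2 tends to 1 ([cvg_P_fun]).

    All this requires the seminorms |u|_(k+q+1) to be nonzero, whereas the limit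
    of their ratios only says so for large q, and |u|_(k+1) occurs in every
    h*_q.  What remains to be shown is that a vanishing seminorm makes all the
    higher ones vanish ([sobolev_seminorm_eq0_le]): the ratios would then
    be eventually 0, and l with them.  Now |u|_r = 0 says that u is orthogonal
    to all derivatives of order r of test functions; a derivative of order r + 1
    of a test function is one of order r of another test function, so the weak
    derivatives of order r + 1 are orthogonal to all test functions; and an L^2
    function with this property vanishes almost everywhere
    ([fundamental_lemma]).

    That fundamental lemma of the calculus of variations is proved with explicit
    bump functions.  Products of one-variable bumps exp(- c / ((t - a)(d - t)))
    increase to the indicator of a box as c decreases to 0, so the integral of g
    over every box is 0 by dominated convergence; Dynkin's pi-lambda theorem
    turns this into g = 0 almost everywhere on each box whose closure lies in
    Omega, and countably many of these cover Omega. *)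

(** * Asymptotics of the critical mesh size *)

Lemma cvgn_ext (T : topologicalType) (f g : nat -> T) (x : T) :
  f =1 g -> f @ \oo --> x -> g @ \oo --> x.
Proof. by move=> /funext ->. Qed.

(** On logarithms this is Cesaro's theorem: ln (Y q) / q is, up to a vanishing
    term, the mean of the increments of ln (Y q), which tend to 0. *)
Lemma cvg_root_of_ratio (R : realType) (Y : nat -> R) :
  (forall q, 0 < Y q) -> (fun q => Y q.+1 / Y q) @ \oo --> (1 : R) ->
  (fun q => Y q `^ (q%:R^-1)) @ \oo --> (1 : R).
Proof.
move=> Y0 Y1.
have lnY : (fun q => ln (Y q.+1) - ln (Y q)) @ \oo --> (0 : R).
  rewrite -(@ln1 R); apply: (@cvgn_ext _ (@ln R \o fun q => Y q.+1 / Y q)).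
    by move=> q; rewrite /= ln_div// posrE.
  by apply: continuous_cvg => //; apply: continuous_ln.
have meanY : (fun q => ln (Y q) * q%:R^-1) @ \oo --> (0 : R).
  rewrite -cvg_shiftS.
  have -> : (fun q => ln (Y q.+1) * q.+1%:R^-1) =
    (fun q => arithmetic_mean (fun q => ln (Y q.+1) - ln (Y q)) q
              + ln (Y 0%N) * q.+1%:R^-1).
    apply/funext => q; rewrite /arithmetic_mean/=.
    by rewrite /series/= telescope_sumr//; ring.
  have := cvgD (cesaro lnY) (cvgM (cvg_cst (ln (Y 0%N))) (@cvg_harmonic R)).
  rewrite mulr0 addr0; exact.
apply: (@cvgn_ext _ (@expR R \o fun q => ln (Y q) * q%:R^-1)).
  by move=> q; rewrite /powR gt_eqF//= mulrC.
suff : (expR \o fun q => ln (Y q) * q%:R^-1) @ \oo --> (expR 0 : R).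
  by rewrite expR0.
by apply: continuous_cvg => //; exact: continuous_expR.
Qed.

Lemma cvg_natr_ratio (R : realType) (a b : R) :
  (fun q : nat => (q%:R + a) / (q%:R + b)) @ \oo --> (1 : R).
Proof.
rewrite -cvg_shiftS.
have inv0 : (fun q : nat => q.+1%:R^-1 : R) @ \oo --> (0 : R).
  exact: cvg_harmonic.
have D c : (fun q : nat => 1 + c * q.+1%:R^-1) @ \oo --> (1 : R).
  have := cvgD (cvg_cst (1:R)) (cvgM (cvg_cst c) inv0).
  rewrite mulr0 addr0; exact.
rewrite (_ : (fun q : nat => _) =
  (fun q : nat => (1 + a * q.+1%:R^-1) / (1 + b * q.+1%:R^-1))).
  have := cvgM (D a) (cvgV (oner_neq0 R) (D b)).
  rewrite divr1; exact.
apply/funext => q.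
have q0 : q.+1%:R != 0 :> R by rewrite pnatr_eq0.
rewrite -[in LHS](mulfK q0 a) -[in LHS](mulfK q0 b).
rewrite -[X in X + _ / _ ](mul1r _) -[X in _ / (X + _)](mul1r _).
rewrite -[a * _ / _]mulrAC -[b * _ / _]mulrAC -!mulrDl.
by rewrite -mulf_div divff// mulr1.
Qed.

(** Both bounds on q ln (1 + 1 / q) come from ln (1 + x) <= x, applied to
    x = 1 / q and to x = - 1 / (q + 1). *)
Lemma cvg_expr_succ_ratio (R : realType) :
  (fun q : nat => (q%:R / q.+1%:R) ^+ q) @ \oo --> (expR (- 1) : R).
Proof.
have L : (fun q : nat => - (q%:R * ln (1 + q%:R^-1))) @ \oo --> (- 1 : R).
  apply: cvgN; apply: squeeze_cvgr; last first.
  - exact: (@cvg_cst _ (1:R)).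
  - exact: (cvg_natr_ratio 0 1).
  near=> q.
  have q0 : (0 < q%:R :> R) by rewrite ltr0n; near: q; exists 1%N.
  apply/andP; split; last first.
    rewrite -[leRHS](@divff _ (q%:R : R)) ?gt_eqF//.
    apply: ler_wpM2l; [exact: ltW|apply: le_ln1Dx].
    by rewrite (lt_trans _ (_ : 0 < _)) ?invr_gt0// ltrN10.
  rewrite addr0; apply: ler_wpM2l; first exact: ltW.
  have -> : 1 + q%:R^-1 = (1 - (q%:R + 1)^-1)^-1 :> R.
    by field; rewrite !gt_eqF//; lra.
  rewrite lnV ?posrE; last first.
    by rewrite subr_gt0 invf_lt1//; lra.
  rewrite lerNr; apply: le_ln1Dx.
  by rewrite ltrN2 invf_lt1; lra.
have E : (expR \o fun q : nat => - (q%:R * ln (1 + q%:R^-1))) @ \oo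
    --> (expR (- 1) : R).
  by apply: continuous_cvg => //; exact: continuous_expR.
apply: cvg_trans E; apply: near_eq_cvg; near=> q.
have q0 : (0 < q%:R :> R) by rewrite ltr0n; near: q; exists 1%N.
rewrite /= expRN expRM_natl lnK ?posrE ?addr_gt0 ?invr_gt0//.
rewrite -exprVn; congr (_ ^+ _); rewrite -natr1.
by field; rewrite !gt_eqF//; lra.
Unshelve. all: by end_near. Qed.

Lemma C_star_gt0 (R : realType) (n : nat) (M alpha C : R) (k : nat) :
  (0 < n)%N -> 0 < M -> 0 < alpha -> 0 < C -> n%:R / 2 < k%:R :> R ->
  0 < C_star n M alpha C k.
Proof.
move=> n0 M0 a0 C0 kn.
have k0 : (0 < k)%N.
  by rewrite -(ltr_nat R) (le_lt_trans _ kn)// divr_ge0.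
rewrite /C_star; apply: mulr_gt0; first by rewrite divr_gt0 ?mulr_gt0.
apply: divr_gt0; last by rewrite mulr_gt0 ?subr_gt0// ltr0n fact_gt0.
by apply: mulr_gt0; apply: exprn_gt0; rewrite ltr0n// addn_gt0 k0.
Qed.

(** The factorial contributes k + q to the ratio of consecutive constants, which
    the extra q + 1 compensates; everything else is a product of quotients of
    affine functions of q with leading coefficient 1. *)
Lemma cvg_C_star_ratio (R : realType) (n : nat) (M alpha C : R) (k : nat) :
  (0 < n)%N -> 0 < M -> 0 < alpha -> 0 < C -> n%:R / 2 < k%:R :> R ->
  (fun q => C_star n M alpha C (k + q) /
    (C_star n M alpha C (k + q.+1) * q.+1%:R)) @ \oo --> (1 : R).
Proof.
move=> n0 M0 a0 C0 kn.
have k0 : (0 < k)%N.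
  by rewrite -(ltr_nat R) (le_lt_trans _ kn)// divr_ge0.
pose r (a b : R) (q : nat) := (q%:R + a) / (q%:R + b).
pose K : R := k%:R; pose m : R := n%:R.
(* The factors come from the powers (k + q + n) ^ n and (k + q) ^ (n + 2), from
   the factorial together with the division by q + 1, and from k + q - n / 2. *)
apply: (@cvgn_ext _ (fun q => r (K + m) (K + m + 1) q ^+ n
   * r K (K + 1) q ^+ n.+2 * r K 1 q * r (K + 1 - m / 2) (K - m / 2) q)).
  move=> q; rewrite /r /C_star.
  have q0 : 0 <= q%:R :> R by [].
  have K0 : 0 < K by rewrite /K ltr0n.
  have m0 : 0 < m by rewrite /m ltr0n.
  have -> : (k + q).-1`!%:R = (k + q.+1).-1`!%:R / (q%:R + K) :> R.
    rewrite addnS/= -[in RHS](@prednK (k + q)) ?addn_gt0 ?k0// factS natrM.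
    rewrite prednK ?addn_gt0 ?k0// natrD addrC mulrAC divff ?mul1r//.
    by rewrite gt_eqF//; lra.
  have fact0 : (k + q.+1).-1`!%:R != 0 :> R by rewrite pnatr_eq0 -lt0n fact_gt0.
  have MC0 : M * C / alpha != 0 by rewrite gt_eqF ?divr_gt0 ?mulr_gt0.
  have E1 : (k + q)%:R = q%:R + K :> R by rewrite natrD addrC.
  have E2 : (k + q.+1)%:R = q%:R + K + 1 :> R by rewrite addnS -natr1 E1.
  have E3 : (k + q + n)%:R = q%:R + (K + m) :> R by rewrite natrD E1 addrA.
  have E4 : (k + q.+1 + n)%:R = q%:R + (K + m + 1) :> R.
    by rewrite natrD E2 -/m; lra.
  rewrite E3 E4 E1 E2 -natr1 -/m !addrA.
  rewrite !expr_div_n.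
  have kn' : m / 2 < K by [].
  field.
  rewrite fact0 !expf_neq0 ?MC0 /= ?gt_eqF//; lra.
have rr (a b : R) := cvg_natr_ratio a b.
have mul1 (f g : nat -> R) : f @ \oo --> (1 : R) -> g @ \oo --> (1 : R) ->
    (fun q : nat => f q * g q) @ \oo --> (1 : R).
  by move=> f1 g1; have := cvgM f1 g1; rewrite mulr1; exact.
have cvgX f p : f @ \oo --> (1 : R) ->
    (fun q : nat => f q ^+ p) @ \oo --> (1 : R).
  move=> f1; elim: p => [|p IH]; first exact: cvg_cst.
  apply: (@cvgn_ext _ (fun q => f q * f q ^+ p)).
    by move=> q; rewrite exprS.
  exact: (mul1 _ _ f1 IH).
exact: (mul1 _ _ (mul1 _ _ (mul1 _ _ (cvgX _ _ (rr _ _)) (cvgX _ _ (rr _ _)))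
  (rr _ _)) (rr _ _)).
Qed.

(** The sequence s stands for the seminorms |u|_(k+q+1), of which only the
    positivity and the limit of the ratios matter. *)
Lemma h_star_asymptotics (R : realType) (n : nat) (M alpha C : R) (k : nat)
    (s : nat -> R) (l : R) :
  (0 < n)%N -> 0 < M -> 0 < alpha -> 0 < C -> n%:R / 2 < k%:R :> R ->
  (forall q, 0 < s q) -> 0 < l ->
  (fun q => s q.+1 / s q) @ \oo --> l ->
  (fun q => ((C_star n M alpha C k * s 0%N) /
             (C_star n M alpha C (k + q) * s q)) `^ (q%:R^-1)
            / (1 / (expR 1 * l) * q%:R)) @ \oo --> (1 : R).
Proof.
move=> n0 M0 a0 C0 kn s0 l0 sl.
have Ck q : 0 < C_star n M alpha C (k + q).
  by apply: C_star_gt0 => //; rewrite (lt_le_trans kn)// ler_nat leq_addr.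
set A := C_star n M alpha C k * s 0%N.
have A0 : 0 < A by rewrite mulr_gt0//; have := Ck 0%N; rewrite addn0.
set B := fun q => C_star n M alpha C (k + q) * s q.
have B0 q : 0 < B q by rewrite mulr_gt0.
have el0 : 0 < expR 1 * l by rewrite mulr_gt0 ?expR_gt0.
(* The q-th root of Y q is the quotient under study; at q = 0 the second factor
   is 1, so that Y is positive everywhere. *)
pose Y q : R := A / B q * (expR 1 * l / q%:R) ^+ q.
have Y0 q : 0 < Y q.
  apply: mulr_gt0; first by rewrite divr_gt0.
  by case: q => [|q]; rewrite ?expr0// exprn_gt0// divr_gt0// ltr0n.
have Y1 : (fun q => Y q.+1 / Y q) @ \oo --> (1 : R).
  have L : (fun q => C_star n M alpha C (k + q) /
        (C_star n M alpha C (k + q.+1) * q.+1%:R) * (s q.+1 / s q)^-1 *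
      (expR 1 * l * (q%:R / q.+1%:R) ^+ q)) @ \oo --> (1 : R).
    suff : (fun q => C_star n M alpha C (k + q) /
        (C_star n M alpha C (k + q.+1) * q.+1%:R) * (s q.+1 / s q)^-1 *
      (expR 1 * l * (q%:R / q.+1%:R) ^+ q)) @ \oo -->
        (1 * l^-1 * (expR 1 * l * expR (- 1)) : R).
      rewrite (_ : 1 * l^-1 * _ = 1); [by []|].
      by rewrite expRN; field; rewrite !gt_eqF// expR_gt0.
    apply: cvgM; first apply: cvgM.
    - exact: cvg_C_star_ratio.
    - by apply: cvgV; rewrite ?lt0r_neq0.
    - by apply: cvgM; [exact: cvg_cst|exact: cvg_expr_succ_ratio].
  apply: cvg_trans L; apply: near_eq_cvg; near=> q.
  have q0 : (0 < q%:R :> R) by rewrite ltr0n; near: q; exists 1%N.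
  rewrite /Y /B /= !expr_div_n (exprS (expR 1 * l)) (exprS q.+1%:R).
  have := Ck q; have := Ck q.+1; have := s0 q; have := s0 q.+1.
  move: (C_star _ _ _ _ (k + q)) (C_star _ _ _ _ (k + q.+1)) (s q) (s q.+1).
  move=> c1 c2 s1 s2 s20 s10 c20 c10.
  have := exprn_gt0 q el0; have := exprn_gt0 q q0.
  have q10 : 0 < q.+1%:R :> R by rewrite ltr0n.
  have := exprn_gt0 q q10.
  set q1 : R := q.+1%:R in q10 *; move: q1 q10 => q1 q10.
  move: ((expR 1 * l) ^+ q) (q%:R ^+ q) (q1 ^+ q).
  move=> e1 x1 x2 x20 x10 e10.
  by field; rewrite !gt_eqF.
apply: cvg_trans (cvg_root_of_ratio Y0 Y1); apply: near_eq_cvg; near=> q.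
have q0 : (0 < q)%N by near: q; exists 1%N.
have q0' : (0 < q%:R :> R) by rewrite ltr0n.
rewrite /Y powRM; last 2 first.
- by rewrite divr_ge0// ltW.
- by rewrite exprn_ge0// divr_ge0// ltW.
rewrite -powR_mulrn ?divr_ge0// ?(ltW el0)// -powRrM divff ?gt_eqF// powRr1.
  by field; rewrite !gt_eqF// ?expR_gt0.
by rewrite divr_ge0// ltW.
Unshelve. all: by end_near. Qed.

(** * Smooth bump functions *)

Section flat_function.
Variables (R : realType) (c : R).
Hypothesis c0 : 0 < c.

(** The classical function exp (- c / w), extended by 0 to w <= 0 and multiplied
    by powers of 1 / w: the derivative of such a function is a combination of
    two functions of the same family. *)
Definition flat (N : nat) (w : R) : R :=
  if 0 < w then w^-1 ^+ N * expR (- (c / w)) else 0.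

(** The exponential series gives exp (- x) <= m! / x ^ m; the choice m = N + 2
    absorbs the N powers of 1 / w and leaves a factor w ^ 2, which makes the
    derivative at 0 vanish. *)
Lemma flat_le_sqr N : exists2 K : R, 0 <= K &
  forall w, `|flat N w| <= K * w ^+ 2.
Proof.
exists (N.+2`!%:R / c ^+ N.+2) => [|w].
  by rewrite divr_ge0// exprn_ge0// ltW.
rewrite /flat; case: ifPn => [w0|_]; last first.
  by rewrite normr0 mulr_ge0 ?sqr_ge0// divr_ge0// exprn_ge0// ltW.
have cw0 : 0 < c / w by rewrite divr_gt0.
rewrite ger0_norm; last first.
  by apply: mulr_ge0; [rewrite exprn_ge0// invr_ge0 ltW|exact: expR_ge0].
have H : (c / w) ^+ N.+2 / N.+2`!%:R <= expR (c / w).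
  by apply: le_trans (expR_ge1Dxn N.+1 (ltW cw0)); rewrite lerDr.
have f0 : 0 < N.+2`!%:R :> R by rewrite ltr0n fact_gt0.
have H2 : expR (- (c / w)) <= N.+2`!%:R / (c / w) ^+ N.+2.
  rewrite expRN -[leRHS]invf_div lef_pV2// posrE ?expR_gt0//.
  by rewrite divr_gt0// exprn_gt0.
apply: le_trans (ler_wpM2l _ H2) _.
  by rewrite exprn_ge0// invr_ge0 ltW.
rewrite le_eqVlt; apply/orP; left; apply/eqP.
rewrite expr_div_n exprVn (exprS w N.+1) (exprS w N).
by field; rewrite !expf_neq0 ?gt_eqF.
Qed.

Lemma is_derive_flat N (w : R) :
  is_derive w 1 (flat N) (c * flat N.+2 w - N%:R * flat N.+1 w).
Proof.
have [w0|w0] := ltP 0 w; last first.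
  have -> : c * flat N.+2 w - N%:R * flat N.+1 w = 0.
    by rewrite /flat ltNge w0/= !mulr0 subr0.
  move: w0; rewrite le_eqVlt => /predU1P[->|w0].
    have [K K0 HK] := flat_le_sqr N.
    have L : (fun h : R => h^-1 *: (flat N (h *: 1 + 0) - flat N 0)) @ 0^'
        --> (0 : R).
      apply/cvgr0Pnorm_le => e e0.
      near=> h.
      have h0 : h != 0 by near: h; exact: nbhs_dnbhs_neq.
      have hK : `|h| <= e / (K + 1).
        near: h; apply: dnbhs0_le; rewrite divr_gt0//.
        by rewrite (le_lt_trans K0)// ltrDl.
      rewrite {2}/flat ltxx subr0 addr0 [_ *: 1]mulr1 normrZ normfV.
      rewrite ler_pdivrMl ?normr_gt0//.
      apply: (le_trans (HK h)).
      rewrite -real_normK ?num_real// expr2 mulrA mulrC ler_wpM2l//.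
      apply: le_trans (ler_wpM2l K0 hK) _.
      rewrite mulrA ler_pdivrMr; last by rewrite (le_lt_trans K0)// ltrDl.
      by rewrite mulrC ler_wpM2l ?(ltW e0)// lerDl.
    apply: DeriveDef; first by apply/cvg_ex; exists 0.
    exact/cvg_lim.
  apply: near_eq_is_derive (is_derive_cst 0 _ _).
  near=> x; rewrite /flat ifF//; apply/negbTE; rewrite -leNgt ltW//.
  by near: x; exact: lt_nbhsl.
(* For w > 0, flat N is s ^ N exp (- c s) composed with s = 1 / w. *)
have iV : is_derive w 1 (fun x : R => x^-1) (- w ^- 2 *: 1).
  by apply: is_deriveV; rewrite gt_eqF.
have iF : is_derive w^-1 1 ((id ^+ N) * (expR \o (- c \*: id)) : R -> R)
    (w^-1 ^+ N * (expR (- c * w^-1) * (- c)) +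
     expR (- c * w^-1) * (N%:R * w^-1 ^+ N.-1)).
  apply: is_derive_eq.
  by rewrite /= !fctE /GRing.scale /= !mulr1.
have := is_derive1_comp iF iV.
rewrite (_ : _ * _ = c * flat N.+2 w - N%:R * flat N.+1 w).
  apply: near_eq_is_derive; near=> x.
  rewrite /flat ifT; last by near: x; exact: lt_nbhsr.
  by rewrite !fctE /= [_ *: _]mulNr.
rewrite /flat !ifT// /GRing.scale /= mulr1 mulNr; set e := expR _.
rewrite -exprVn !exprS; case: (N) => [|m]; first by rewrite expr0; ring.
by rewrite /= exprS; ring.
Unshelve. all: by end_near. Qed.

End flat_function.

Section bump1.
Variables (R : realType) (c : R).
Hypothesis c0 : 0 < c.

Definition hump (a d : R) : {poly R} := ('X - a%:P) * (d%:P - 'X).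

(** The parameters p and N make the family closed under derivation; the bump
    itself is the member with p = 1 and N = 0. *)
Definition bump1 (a d : R) (p : {poly R}) (N : nat) (t : R) : R :=
  p.[t] * flat c N (hump a d).[t].

(** Used to bring the terms of a derivative to the same N. *)
Lemma flatS (N : nat) (w : R) : flat c N w = w * flat c N.+1 w.
Proof.
rewrite /flat; case: ifPn => [w0|_]; last by rewrite mulr0.
by rewrite exprS !mulrA divff ?mul1r// gt_eqF.
Qed.

Lemma is_derive_bump1 (a d : R) (p : {poly R}) (N : nat) (t : R) :
  is_derive t 1 (bump1 a d p N)
    (bump1 a d (p^`() * hump a d ^+ 2
      + p * (c%:P - N%:R *: hump a d) * (hump a d)^`()) N.+2 t).
Proof.
have H := is_derive1_comp (is_derive_flat c0 N (hump a d).[t])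
  (is_derive_poly (hump a d) t).
have HM := is_deriveM (is_derive_poly p t) H.
apply: (is_derive_eq HM).
rewrite /GRing.scale /= /bump1 [flat c N _]flatS !(flatS N.+1)
  !(hornerD, hornerM, hornerN, hornerZ, hornerC, horner_exp).
by ring.
Qed.

End bump1.

Section product_functions.
Variables (R : realType) (n : nat).

Definition tensor (f : 'I_n -> R -> R) (x : 'rV[R]_n) : R :=
  \prod_i f i (x 0 i).

Lemma is_derive_tensor (f : 'I_n -> R -> R) (j : 'I_n) (x : 'rV[R]_n) :
  derivable (f j) (x 0 j) 1 ->
  is_derive x (delta_mx 0 j : 'rV[R]_n) (tensor f)
    (tensor (fun i => if i == j then 'D_1 (f j) else f i) x).
Proof.
move=> dfj; set P := \prod_(i | i != j) f i (x 0 i).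
have -> : tensor (fun i => if i == j then 'D_1 (f j) else f i) x =
    'D_1 (f j) (x 0 j) * P.
  rewrite /tensor (bigD1 j)//= eqxx; congr (_ * _).
  by apply: eq_bigr => i /negbTE ->.
have E : (fun h : R => h^-1 *: (tensor f (h *: delta_mx 0 j + x) - tensor f x))
   = (fun h => (h^-1 *: (f j (h *: 1 + x 0 j) - f j (x 0 j))) * P).
  apply/funext => h; rewrite /tensor (bigD1 j)//= [X in _ - X](bigD1 j)//=.
  rewrite -/P !mxE !eqxx.
  rewrite (_ : \prod_(i | i != j) _ = P) -?mulrBl ?scalerAl//.
  by apply: eq_bigr => i /negbTE ij; rewrite !mxE eqxx ij/= mulr0 add0r.
have L : (fun h : R => h^-1 *: (tensor f (h *: delta_mx 0 j + x) - tensor f x))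
    @ 0^' --> 'D_1 (f j) (x 0 j) * P.
  by rewrite E; apply: cvgM; [exact: dfj|exact: cvg_cst].
apply: DeriveDef; first by apply/cvg_ex; eexists; exact: L.
exact/cvg_lim.
Qed.

Lemma continuous_tensor (f : 'I_n -> R -> R) :
  (forall i, continuous (f i)) -> continuous (tensor f).
Proof.
move=> cf x; rewrite /tensor.
elim: (index_enum _) => [|i s IH].
  rewrite (_ : (fun _ => _) = cst 1); first exact: cst_continuous.
  by apply/funext => y; rewrite big_nil.
rewrite (_ : (fun _ => _) =
    (fun y : 'rV[R]_n => f i (y 0 i) * \prod_(j <- s) f j (y 0 j))); last first.
  by apply/funext => y; rewrite big_cons.
apply: continuousM => //.
apply: continuous_comp; [exact: coord_continuous|exact: cf].
Qed.

(** Partial derivatives of a product of one-variable functions act on one factor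
    at a time, so iterating them stays within the products of functions taken
    from classes closed under derivation. *)
Lemma smooth_tensor (S : 'I_n -> set (R -> R)) :
  (forall i f, S i f -> (forall t, derivable f t 1) /\ S i ('D_1 f)) ->
  forall f, (forall i, S i (f i)) -> smooth (tensor f).
Proof.
move=> clS.
have H f s : (forall i, S i (f i)) ->
    exists2 g, forall i, S i (g i) &
      foldr (@partial R n) (tensor f) s = tensor g.
  move=> Sf; elim: s => [|j s [g Sg /= ->]]; first by exists f.
  exists (fun i => if i == j then 'D_1 (g j) else g i).
    move=> i; case: eqP => [->|_]; last exact: Sg.
    exact: (clS _ _ (Sg j)).2.
  apply/funext => x; rewrite /partial.
  have dg := @is_derive_tensor _ _ _ ((clS _ _ (Sg j)).1 (x 0 j)).
  exact: (@derive_val _ _ _ _ _ _ _ dg).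
move=> f Sf s; have [g Sg /= ->] := H f s Sf; split.
  apply: continuous_tensor => i t; apply: differentiable_continuous.
  exact/derivable1_diffP/(clS _ _ (Sg i)).1.
move=> i x.
have dg := @is_derive_tensor _ _ _ ((clS _ _ (Sg i)).1 (x 0 i)).
exact: (@ex_derive _ _ _ _ _ _ _ dg).
Qed.
End product_functions.

Section bump.
Variables (R : realType) (n : nat).

Definition open_box (a d : 'rV[R]_n) : set 'rV[R]_n :=
  [set x | forall i, a 0 i < x 0 i < d 0 i].
Definition closed_box (a d : 'rV[R]_n) : set 'rV[R]_n :=
  [set x | forall i, a 0 i <= x 0 i <= d 0 i].

Definition bump (a d : 'rV[R]_n) (c : R) : 'rV[R]_n -> R :=
  tensor (fun i => bump1 c (a 0 i) (d 0 i) 1 0).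

Lemma open_box_sub_closed a d : open_box a d `<=` closed_box a d.
Proof. by move=> x xB i; have /andP[? ?] := xB i; rewrite !ltW. Qed.

Lemma compact_closed_box a d : compact (closed_box a d).
Proof.
have -> : closed_box a d =
    [set v : 'rV[R]_n | forall i, `[a 0 i, d 0 i]%classic (v ord0 i)].
  by apply/seteqP; split => x H i; move: (H i); rewrite /= in_itv.
apply: (@rV_compact R n (fun i => `[a 0 i, d 0 i]%classic)) => i.
exact: segment_compact.
Qed.

Lemma smooth_bump a d c : 0 < c -> smooth (bump a d c).
Proof.
move=> c0; apply: (@smooth_tensor _ _
  (fun i => [set f | exists p N, f = bump1 c (a 0 i) (d 0 i) p N])).
  move=> i _ [p [N ->]]; split.
    move=> t; have db := is_derive_bump1 c0 (a 0 i) (d 0 i) p N t.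
    exact: (@ex_derive _ _ _ _ _ _ _ db).
  eexists; eexists; apply/funext => t.
  have db := is_derive_bump1 c0 (a 0 i) (d 0 i) p N t.
  exact: (@derive_val _ _ _ _ _ _ _ db).
by move=> i; exists 1, 0%N.
Qed.

Lemma bump_in a d c x : open_box a d x ->
  bump a d c x = expR (- (c * \sum_i ((x 0 i - a 0 i) * (d 0 i - x 0 i))^-1)).
Proof.
move=> H; rewrite /bump /tensor mulr_sumr -sumrN expR_sum.
apply: eq_bigr => i _.
rewrite /bump1 /flat /hump !hornerE.
by have /andP[? ?] := H i; rewrite mulr_gt0 ?subr_gt0// mul1r.
Qed.

(** The hypothesis a <= d matters: for d < a the polynomial (t - a) (d - t) is
    positive between d and a. *)
Lemma bump_out (a d : 'rV[R]_n) c x : (forall i, a 0 i <= d 0 i) ->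
  ~ open_box a d x -> bump a d c x = 0.
Proof.
move=> ad /existsNP[i /negP Hi]; rewrite /bump /tensor (bigD1 i)//=.
rewrite /bump1 /flat /hump !hornerE ifF ?mulr0 ?mul0r//.
apply/negbTE; rewrite -leNgt; move: Hi; rewrite negb_and -!leNgt => /orP[xa|dx].
  by rewrite mulr_le0_ge0 ?subr_le0 ?subr_ge0// (le_trans xa).
by rewrite mulr_ge0_le0 ?subr_le0 ?subr_ge0// (le_trans (ad i)).
Qed.
End bump.

(** * Boxes and Lebesgue measure *)

Section boxes.
Variables (R : realType) (n : nat).
Implicit Types (a d : 'rV[R]_n).

Lemma measurable_coordinatewise (A : 'I_n -> set (measurableTypeR R)) :
  (forall i, measurable (A i)) ->
  measurable [set x : 'rV[R]_n | forall i, A i (x 0 i)].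
Proof.
move=> mA.
have -> : [set x : 'rV[R]_n | forall i, A i (x 0 i)] =
   \bigcap_(i in [set: 'I_n]) ((fun x : 'rV[R]_n => x ord0 i) @^-1` A i).
  by apply/seteqP; split=> x /= H i; [move=> _; exact: H|exact: (H i Logic.I)].
apply: fin_bigcap_measurable => [|i _]; first exact: finite_finset.
by rewrite -[X in measurable X]setTI; apply: measurable_coor_rV.
Qed.

Lemma measurable_open_box a d : measurable (open_box a d).
Proof.
have -> : open_box a d =
    [set x | forall i, `]a 0 i, d 0 i[%classic (x 0 i)].
  by apply/seteqP; split=> x H i; move: (H i); rewrite /= in_itv.
apply: (@measurable_coordinatewise (fun i => `]a 0 i, d 0 i[%classic)) => i.
exact: measurable_itv.
Qed.

Lemma measurable_closed_box a d : measurable (closed_box a d).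
Proof.
have -> : closed_box a d =
    [set x | forall i, `[a 0 i, d 0 i]%classic (x 0 i)].
  by apply/seteqP; split=> x H i; move: (H i); rewrite /= in_itv.
apply: (@measurable_coordinatewise (fun i => `[a 0 i, d 0 i]%classic)) => i.
exact: measurable_itv.
Qed.

(** Orthants are a pi-system like open boxes, but their intersection with a box
    is again a box, which lets them test a function supported in a box. *)
Definition orthant a : set 'rV[R]_n := [set x | forall i, a 0 i < x 0 i].

Lemma measurable_orthant a : measurable (orthant a).
Proof.
have -> : orthant a =
    [set x | forall i, `]a 0 i, +oo[%classic (x 0 i)].
  by apply/seteqP; split=> x H i; move: (H i); rewrite /= in_itv/= andbT.
apply: (@measurable_coordinatewise (fun i => `]a 0 i, +oo[%classic)) => i.
exact: measurable_itv.
Qed.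

Lemma orthantI a d : orthant a `&` orthant d =
  orthant (\row_i Num.max (a 0 i) (d 0 i)).
Proof.
apply/seteqP; split=> x /=.
  by move=> [H1 H2] i; rewrite mxE gt_max H1 H2.
by move=> H; split => i; move: (H i); rewrite mxE gt_max => /andP[].
Qed.

Lemma orthant_open_boxI a b d : orthant b `&` open_box a d =
  open_box (\row_i Num.max (a 0 i) (b 0 i)) d.
Proof.
apply/seteqP; split=> x /=.
  by move=> [H1 H2] i; rewrite mxE gt_max H1 andbT; exact: H2.
move=> H; split => i; have := H i; rewrite mxE gt_max => /andP[/andP[? ?] ?]//.
exact/andP.
Qed.

(** The half-space t < x_i is the union over m of the orthants whose corner has
    i-th coordinate t and all the others equal to - m. *)
Lemma measurable_rV_orthants :
  @measurable _ 'rV[R]_n = <<s [set A | exists a, A = orthant a] >>.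
Proof.
apply/seteqP; split; last first.
  apply: smallest_sub; first exact: sigma_algebra_measurable.
  by move=> _ [a ->]; exact: measurable_orthant.
apply: smallest_sub; first exact: smallest_sigma_algebra.
move=> B; rewrite -bigcup_seq => -[i _] /= [Y mY <-]; rewrite setTI.
pose T : measurableType _ :=
  g_sigma_algebraType [set A | exists a : 'rV[R]_n, A = orthant a].
have mi : measurable_fun [set: T]
    (fun x : T => (x : 'rV[R]_n) ord0 i : measurableTypeR R).
  apply: (measurability _ (RGenOInfty.measurableE R)).
  move=> _ [_ [t ->] <-]; rewrite setTI.
  have -> : (fun x : T => (x : 'rV[R]_n) ord0 i) @^-1` `]t, +oo[%classic =
      \bigcup_m (orthant (\row_j (if j == i then t else - m%:R : R)) : set T).
    apply/seteqP; split=> x /=; last first.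
      by move=> [m _] /(_ i); rewrite mxE eqxx in_itv/= andbT.
    rewrite in_itv/= andbT => tx.
    exists (Num.Def.truncn (\sum_j `|(x : 'rV[R]_n) 0 j|)).+1 => // j.
    rewrite mxE; case: eqP => [->//|_].
    rewrite ltrNl (le_lt_trans _ (truncnS_gt _))// (bigD1 j)//=.
    by rewrite ler_wpDr ?sumr_ge0// -normrN ler_norm.
  apply: bigcupT_measurable => m; apply: sub_sigma_algebra.
  by eexists.
by have := mi measurableT Y mY; rewrite setTI.
Qed.

(** Boxes with rational corners, enumerated by [unpickle]; D selects the codes
    of the boxes whose closure lies in U. *)
Lemma open_eq_bigcup_boxes (U : set 'rV[R]_n) : open U ->
  exists (D : set nat) (a d : nat -> 'rV[R]_n),
    (forall k, D k -> closed_box (a k) (d k) `<=` U) /\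
    U = \bigcup_(k in D) open_box (a k) (d k).
Proof.
move=> oU.
pose q k : 'rV[rat]_n * 'rV[rat]_n := odflt (0, 0) (unpickle k).
pose a k : 'rV[R]_n := map_mx ratr (q k).1.
pose d k : 'rV[R]_n := map_mx ratr (q k).2.
exists [set k | closed_box (a k) (d k) `<=` U], a, d; split => //.
apply/seteqP; split => x; last first.
  by move=> [k /= + xk]; apply; exact: open_box_sub_closed.
move=> Ux.
have /nbhs_ballP[e /= e0 eU] : nbhs x U by exact: open_nbhs_nbhs.
have Ha i : exists r : rat, x 0 i - e < ratr r < x 0 i.
  have /rat_in_itvoo[r] : x 0 i - e < x 0 i by rewrite ltrBlDr ltrDl.
  by rewrite in_itv/=; exists r.
have Hd i : exists r : rat, x 0 i < ratr r < x 0 i + e.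
  have /rat_in_itvoo[r] : x 0 i < x 0 i + e by rewrite ltrDl.
  by rewrite in_itv/=; exists r.
have [fa fa_] := choice Ha; have [fd fd_] := choice Hd.
pose p := (\row_i fa i, \row_i fd i).
have qp : q (pickle p) = p by rewrite /q pickleK.
exists (pickle p) => /=.
  apply: (subset_trans _ eU) => y Hy; split=> // i j; rewrite (ord1 i) /ball /=.
  move: (Hy j) (fa_ j) (fd_ j); rewrite /a /d qp !mxE.
  move=> /andP[? ?] /andP[? ?] /andP[? ?].
  rewrite ltr_distlC; apply/andP; lra.
move=> j; rewrite /a /d qp !mxE.
by have /andP[_ ->] := fa_ j; have /andP[-> _] := fd_ j.
Qed.

Lemma open_measurable_rV (U : set 'rV[R]_n) : open U -> measurable U.
Proof.
move=> /open_eq_bigcup_boxes[D [a [d [_ ->]]]].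
by apply: bigcup_measurable => k _; exact: measurable_open_box.
Qed.

Lemma continuous_measurable_fun_rV (f : 'rV[R]_n -> R) (D : set 'rV[R]_n) :
  continuous f -> measurable_fun D (f : _ -> measurableTypeR R).
Proof.
move=> cf; apply: (@measurable_funS _ _ _ _ setT) => //.
apply: (measurability _ (RGenOInfty.measurableE R)).
move=> _ [_ [t ->] <-]; rewrite setTI; apply: open_measurable_rV.
by apply: open_comp => [x _|]; [exact: cf|exact: interval_open].
Qed.
End boxes.

Lemma lebesgue_closed_box_lty (R : realType) (n : nat) (a d : 'rV[R]_n) :
  (lebesgue_rV R n (closed_box a d) < +oo)%E.
Proof.
elim: n a d => [|n IH] a d.
  by rewrite /= /dirac indicE ltry.
rewrite /= /lebesgue_rV_step /pushforward.
pose a' : 'rV[R]_n := \row_j a 0 (lift ord0 j).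
pose d' : 'rV[R]_n := \row_j d 0 (lift ord0 j).
rewrite (_ : _ @^-1` _ = `[a 0 0, d 0 0]%classic `*` closed_box a' d').
  rewrite product_measure1E//=; last exact: measurable_closed_box.
  rewrite lte_mul_pinfty//.
    by rewrite lebesgue_measure_itv/=; case: ifP.
apply/seteqP; split => -[x v] /=.
  move=> H; split; first by rewrite in_itv/=; have := H ord0; rewrite cons_rV0.
  by move=> j; have := H (lift ord0 j); rewrite cons_rVS !mxE.
move=> [H1 H2] i; case: (unliftP ord0 i) => [j|] ->; last first.
  by rewrite cons_rV0; move: H1; rewrite in_itv.
by rewrite cons_rVS; have := H2 j; rewrite !mxE.
Qed.

(** * The fundamental lemma of the calculus of variations *)

(** The sets over which h has integral 0 form a Dynkin system; it contains the
    pi-system of orthants, hence every measurable set.  The integral over the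
    whole space is a separate hypothesis because a Dynkin system must contain
    it and it is not an orthant. *)
Lemma ae_eq0_of_orthants (R : realType) (n : nat)
    (mu : {measure set 'rV[R]_n -> \bar R}) (h : 'rV[R]_n -> \bar R) :
  mu.-integrable setT h ->
  (\int[mu]_x h x = 0)%E ->
  (forall a, \int[mu]_(x in orthant a) h x = 0)%E ->
  ae_eq mu setT h (cst 0%E).
Proof.
move=> ih hT ho.
pose H := [set A : set 'rV[R]_n |
  measurable A /\ (\int[mu]_(x in A) h x = 0)%E].
have ihA A : measurable A -> mu.-integrable A h.
  by move=> mA; apply: integrableS ih.
suff mH : forall A, measurable A -> H A.
  apply: integral_ae_eq => // A _ mA.
  by rewrite (mH A mA).2 integral0.
have dynH : dynkin H.
  split; first by split.
    move=> A [mA hA]; split; first exact: measurableC.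
    have := hT; rewrite -(setUv A) integral_setU//; first by rewrite hA add0e.
    - exact: measurableC.
    - by rewrite setUv; case/integrableP : ih.
    - exact/disj_setPCl.
  move=> F tF HF; have mF k := (HF k).1; split; first exact: bigcupT_measurable.
  rewrite integral_bigcup//; last by apply: ihA; exact: bigcupT_measurable.
  by rewrite eseries0// => k _ _; exact: (HF k).2.
have GI : setI_closed [set A | exists a : 'rV[R]_n, A = orthant a].
  by move=> _ _ [a ->] [d ->]; rewrite orthantI; eexists.
have GH : [set A | exists a, A = orthant a] `<=` H.
  by move=> _ [a ->]; split; [exact: measurable_orthant|exact: ho].
have lamH := (dynkin_lambda_system H).1 dynH.
move=> A mA; apply: (lambda_system_subset GI lamH GH) => //.
by rewrite -measurable_rV_orthants.
Qed.

(** Inside the box the bump is exp (- c S) with S independent of c, which tends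
    to 1 with c -> 0; outside it is 0 for every c. *)
Lemma cvg_bump (R : realType) (n : nat) (a d : 'rV[R]_n) :
  (forall i, a 0 i <= d 0 i) -> forall x : 'rV[R]_n,
  (fun m : nat => bump a d m.+1%:R^-1 x) @ \oo --> (\1_(open_box a d) x : R).
Proof.
move=> ad x; rewrite indicE.
have [xB|xB] := boolP (x \in open_box a d); last first.
  rewrite (_ : (fun _ => _) = cst 0); first exact: cvg_cst.
  by apply/funext => m; rewrite bump_out// => xB'; move: xB; rewrite mem_set.
rewrite (_ : (fun _ => _) = fun m : nat => expR (- (m.+1%:R^-1 *
    \sum_i ((x 0 i - a 0 i) * (d 0 i - x 0 i))^-1))); last first.
  by apply/funext => m; rewrite bump_in//; exact: set_mem.
set S := \sum_i _.
suff : (expR \o fun m : nat => - (m.+1%:R^-1 * S)) @ \oo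
    --> (expR (- (0 * S)) : R).
  by rewrite mul0r oppr0 expR0.
apply: continuous_cvg; first exact: continuous_expR.
by apply: cvgN; apply: cvgM; [exact: cvg_harmonic|exact: cvg_cst].
Qed.

Lemma bump_ge0_le_indic (R : realType) (n : nat) (a d x : 'rV[R]_n) c : 0 < c ->
  (forall i, a 0 i <= d 0 i) ->
  0 <= bump a d c x <= \1_(open_box a d) x.
Proof.
move=> c0 ad; rewrite indicE.
have [xB|xB] := boolP (x \in open_box a d); last first.
  by rewrite bump_out ?lexx// => xB'; move: xB; rewrite mem_set.
have {}xB := set_mem xB.
rewrite bump_in// expR_ge0/= -[X in _ <= X](@expR0 R) ler_expR oppr_le0.
rewrite mulr_ge0 ?(ltW c0)//.
by apply: sumr_ge0 => i _; have /andP[? ?] := xB i;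
  rewrite invr_ge0 mulr_ge0// subr_ge0 ltW.
Qed.

Lemma test_function_bump (R : realType) (n : nat) (Omega : set 'rV[R]_n)
    (a d : 'rV[R]_n) c :
  0 < c -> (forall i, a 0 i <= d 0 i) -> closed_box a d `<=` Omega ->
  test_function Omega (bump a d c).
Proof.
move=> c0 ad sub; split; first exact: smooth_bump.
exists (closed_box a d); split => //; first exact: compact_closed_box.
move=> x Kx; apply: bump_out => // xB; apply: Kx.
exact: open_box_sub_closed.
Qed.

Section fundamental_lemma.
Variables (R : realType) (n : nat) (Omega : set 'rV[R]_n).
Hypothesis oOmega : open Omega.
Local Notation leb := (lebesgue_rV R n).
Variable g : 'rV[R]_n -> R.
Hypothesis gL2 : L2 Omega g.

Let mOmega : measurable Omega. Proof. exact: open_measurable_rV. Qed.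

(** A box has finite measure and |g| <= 1 + g ^ 2. *)
Lemma L2_integrable_box a d : closed_box a d `<=` Omega ->
  leb.-integrable (open_box a d) (EFin \o g).
Proof.
move=> sub.
have mB := measurable_open_box a d.
have cl := @open_box_sub_closed _ _ a d.
have BO : open_box a d `<=` Omega by apply: subset_trans sub.
have [mg ig2] := gL2.
have i1 : leb.-integrable (open_box a d) (EFin \o cst (1 : R)).
  apply/integrableP; split; first exact/measurable_EFinP.
  under eq_integral do rewrite /= normr1.
  rewrite integral_cst// mul1e (le_lt_trans _ (lebesgue_closed_box_lty a d))//.
  by apply: le_measure => //; rewrite inE//; exact: measurable_closed_box.
have i2 : leb.-integrable (open_box a d) (fun x => (g x ^+ 2)%:E).
  exact: integrableS ig2.
apply: le_integrable (integrableD mB i1 i2) => //.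
  by apply/measurable_EFinP; exact: measurable_funS mg.
move=> x _; rewrite /= lee_fin [leRHS]ger0_norm; last first.
  by rewrite addr_ge0// sqr_ge0.
rewrite -[g x ^+ 2]real_normK ?num_real//.
have : 0 <= (`|g x| - 2^-1) ^+ 2 by apply: sqr_ge0.
nra.
Qed.

Hypothesis g0 : forall phi, test_function Omega phi ->
  \int[leb]_(x in Omega) (g x * phi x) = 0.

(** The hypothesis is applied to bumps that converge to the indicator of the box
    and are dominated by it, so that |g| is an integrable bound. *)
Lemma box_integral_eq0 a d : closed_box a d `<=` Omega ->
  (\int[leb]_(x in open_box a d) (g x)%:E = 0)%E.
Proof.
move=> sub.
have [ad|/existsNP[i /negP]] := pselect (forall i, a 0 i <= d 0 i); last first.
  rewrite -ltNge => dai; rewrite (_ : open_box a d = set0) ?integral_set0//.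
  apply/seteqP; split=> // x /(_ i) /andP[ax xd].
  by move: dai; rewrite ltNge (ltW (lt_trans ax xd)).
set B := open_box a d.
have mB : measurable B by exact: measurable_open_box.
have ig : leb.-integrable B (EFin \o g) by exact: L2_integrable_box.
have BO : B `<=` Omega.
  by apply: subset_trans sub; exact: open_box_sub_closed.
have c0 (m : nat) : 0 < m.+1%:R^-1 :> R by rewrite invr_gt0 ltr0n.
pose psi (m : nat) := bump a d m.+1%:R^-1.
have mg : measurable_fun B g.
  by apply/measurable_EFinP; exact: (measurable_int leb ig).
have mpsi m : measurable_fun B (psi m).
  exact: continuous_measurable_fun_rV (smooth_bump a d (c0 m) [::]).1.
have mgpsi m : measurable_fun B (fun x => (g x * psi m x)%:E).
  by apply/measurable_EFinP; exact: measurable_funM.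
have le_gpsi m x : B x -> `|g x * psi m x| <= `|g x|.
  move=> xB; rewrite normrM ler_piMr//.
  have /andP[p0 p1] := bump_ge0_le_indic x (c0 m) ad.
  by rewrite ger0_norm// (le_trans p1)// indicE lern1 leq_b1.
have igpsi m : leb.-integrable B (fun x => (g x * psi m x)%:E).
  apply: le_integrable ig => // x xB; rewrite /= lee_fin; exact: le_gpsi.
have int0 m : (\int[leb]_(x in B) (g x * psi m x)%:E = 0)%E.
  have := g0 (test_function_bump (c0 m) ad sub).
  rewrite Rintegral_mkcond.
  rewrite (_ : (_ \_ Omega) = (fun x => g x * psi m x) \_ B).
    (* A real integral equal to 0 could hide an infinite one; integrability
       excludes this. *)
    rewrite -Rintegral_mkcond => H.
    by rewrite -[LHS]fineK ?[fine _]H// integrable_fin_num.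
  apply/funext => x; rewrite /patch; case: ifPn => xO; case: ifPn => xB //.
    rewrite /psi bump_out ?mulr0// => xB'; move: xB; rewrite mem_set//.
  by move: xO; rewrite mem_set//; apply: BO; exact: set_mem.
have [||_ _ /=] := @dominated_convergence _ _ _ leb B mB
  (fun m x => (g x * psi m x)%:E) (EFin \o g) (fun x => `|(g x)%:E|)%E mgpsi
  (measurable_int leb ig) _ (integrable_abse ig) _.
- apply: aeW => x xB; apply: cvg_EFin; first by near=> m.
  suff : (fun m => g x * psi m x) @ \oo --> g x * 1 by rewrite mulr1.
  apply: cvgM; first exact: cvg_cst.
  by have := @cvg_bump _ _ _ _ ad x; rewrite indicE mem_set.
- by apply: aeW => x m xB; rewrite lee_fin; exact: le_gpsi.
under eq_fun do rewrite int0.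
by move=> /cvg_lim <-//; rewrite lim_cst.
Unshelve. all: by end_near. Qed.

(** On a box whose closure lies in Omega, the restriction of g satisfies the
    criterion on orthants because an orthant cuts this box in a smaller one. *)
Lemma fundamental_lemma : ae_eq leb Omega (EFin \o g) (cst 0%E).
Proof.
have [D [a [d [sub OE]]]] := open_eq_bigcup_boxes oOmega.
pose B k := open_box (a k) (d k).
have mB k : measurable (B k) by exact: measurable_open_box.
have nB k : D k -> ae_eq leb setT ((EFin \o g) \_ (B k)) (cst 0%E).
  move=> Dk; apply: ae_eq0_of_orthants.
  - apply/(integrable_mkcond (EFin \o g) (mB k)).
    exact: (L2_integrable_box (sub k Dk)).
  - rewrite -integral_mkcond; apply: box_integral_eq0; exact: sub.
  - move=> b; rewrite -integral_mkcondr orthant_open_boxI.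
    apply: box_integral_eq0.
    apply: subset_trans (sub k Dk) => x xB i; move: (xB i); rewrite mxE ge_max.
    by move=> /andP[/andP[-> _] ->].
rewrite /ae_eq /almost_everywhere.
apply: (@negligibleS _ _ _ _ (\bigcup_k (if k \in D then
  ~` [set x | setT x -> ((EFin \o g) \_ (B k)) x = cst 0%E x] else set0))).
  move=> x /= /not_implyP[]; rewrite {1}OE => -[k Dk xB] gx.
  exists k => //; rewrite mem_set//= => H; apply: gx.
  by have := H Logic.I; rewrite /patch mem_set.
apply: negligible_bigcup => k.
case: ifPn => [kD|_]; last exact: negligible_set0.
by apply: nB; exact: set_mem.
Qed.

End fundamental_lemma.

(** * Vanishing Sobolev seminorms *)

Section sobolev_seminorms.
Variables (R : realType) (n : nat) (Omega : set 'rV[R]_n).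
Hypothesis oOmega : open Omega.
Local Notation leb := (lebesgue_rV R n).

Let mOmega : measurable Omega. Proof. exact: open_measurable_rV. Qed.

Lemma test_function_partial j phi :
  test_function Omega phi -> test_function Omega (partial j phi).
Proof.
move=> [sphi [K [cK KO phi0]]]; split.
  by move=> s; have := sphi (rcons s j); rewrite foldr_rcons.
exists K; split => // x Kx; rewrite /partial.
rewrite (@near_eq_derive _ _ _ _ (cst 0)) ?derive_cst//.
near=> y; apply: phi0; near: y.
have : closed K by apply: compact_closed => //; exact: norm_hausdorff.
rewrite -openC => oK; exact: (open_nbhs_nbhs (conj oK Kx)).
Unshelve. all: by end_near. Qed.

(** [multi_partial] applies the derivatives in a fixed order of the coordinates.
    Splitting off the innermost one respects this order, so that the exchange of
    partial derivatives is never needed. *)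
Lemma multi_partial_innermost (beta : 'I_n -> nat) r :
  multi_order beta = r.+1 ->
  exists j (beta' : 'I_n -> nat), multi_order beta' = r /\
    forall phi : 'rV[R]_n -> R,
      multi_partial beta phi = multi_partial beta' (partial j phi).
Proof.
move=> br.
have : has (fun i => beta i != 0%N) (enum 'I_n).
  apply/negPn/negP => /hasPn H; move: br; rewrite /multi_order big1// => i _.
  by apply/eqP; have := H i; rewrite mem_enum negbK; exact.
have : uniq (enum 'I_n) by exact: enum_uniq.
rewrite /multi_partial; move: (enum 'I_n) => s us hs.
suff [j /andP[js bj] H] : exists2 j, (j \in s) && (beta j != 0%N) &
    forall phi : 'rV[R]_n -> R,
      foldr (fun i f => iter (beta i) (@partial R n i) f) phi s =
      foldr (fun i f => iter (beta i - (i == j))%N (@partial R n i) f)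
        (partial j phi) s.
  exists j, (fun i => (beta i - (i == j))%N); split => //.
  move: br; rewrite /multi_order (bigD1 j)//= => br; rewrite (bigD1 j)//= eqxx.
  rewrite (eq_bigr beta) => [|i /negbTE ->]; last by rewrite subn0.
  by move: bj br; case: (beta j) => // m _; rewrite subn1/= addSn => -[].
elim: s us hs => [//|i s IH] /= /andP[iNs us].
have [hs _|hs] := boolP (has (fun i => beta i != 0%N) s).
  have [j /andP[js bj] H] := IH us hs.
  have /negbTE ij : i != j by apply: contraNneq iNs => ->.
  by exists j => [|phi]; rewrite ?in_cons ?js ?bj ?orbT// H ij subn0.
rewrite orbF => bi; exists i => [|phi]; first by rewrite mem_head.
rewrite eqxx.
have H0 (f : 'rV[R]_n -> R) (b : 'I_n -> nat): (forall k, (b k <= beta k)%N) ->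
   foldr (fun i f => iter (b i) (@partial R n i) f) f s = f.
  move: hs; rewrite -all_predC => + bb; elim: (s) => //= k t IHt /andP[bk ht].
  rewrite IHt//; have := bb k; move: bk; rewrite /= negbK => /eqP ->.
  by rewrite leqn0 => /eqP ->.
rewrite !H0//; last by move=> k; exact: leq_subr.
by move: bi; case: (beta i) => // m _; rewrite subn1 /= -iterSr.
Qed.

Lemma L2_sqr_eq0 g : L2 Omega g ->
  \int[leb]_(x in Omega) (g x ^+ 2) = 0 ->
  ae_eq leb Omega (EFin \o g) (cst 0%E).
Proof.
move=> [mg ig] H.
have H' : (\int[leb]_(x in Omega) `|(g x ^+ 2)%:E| = 0)%E.
  rewrite (eq_integral (fun x => (g x ^+ 2)%:E)).
    by rewrite -[LHS]fineK ?[fine _]H// integrable_fin_num.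
  by move=> x _; rewrite gee0_abs// lee_fin sqr_ge0.
have mg2 := measurable_int leb ig.
have := (ae_eq_integral_abs leb mOmega mg2).1 H'.
rewrite /ae_eq; apply: filterS => x /= h xO.
by have := h xO => -[] /eqP; rewrite sqrf_eq0 => /eqP ->.
Qed.

Lemma ae_eq0_Rintegral_mul (g phi : 'rV[R]_n -> R) : measurable_fun Omega g ->
  measurable_fun Omega phi -> ae_eq leb Omega (EFin \o g) (cst 0%E) ->
  \int[leb]_(x in Omega) (g x * phi x) = 0.
Proof.
move=> mg mphi g0; rewrite /Rintegral (ae_eq_integral (cst 0%E)) ?integral0//.
  by apply/measurable_EFinP; exact: measurable_funM.
move: g0; rewrite /ae_eq; apply: filterS => x /= h xO.
by have [->] := h xO; rewrite mul0r.
Qed.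

Lemma measurable_test_function (phi : 'rV[R]_n -> R) (D : set 'rV[R]_n) :
  test_function Omega phi -> measurable_fun D phi.
Proof.
by move=> [sphi _]; apply: continuous_measurable_fun_rV; have [] := sphi [::].
Qed.

(** The distributional derivatives of order r of u are zero. *)
Definition derivatives_vanish (u : 'rV[R]_n -> R) (r : nat) :=
  forall alpha, multi_order alpha = r -> forall phi, test_function Omega phi ->
    \int[leb]_(x in Omega) (u x * multi_partial alpha phi x) = 0.

Lemma derivatives_vanishS u r :
  derivatives_vanish u r -> derivatives_vanish u r.+1.
Proof.
move=> H beta br phi tphi.
have [j [alpha [ar E]]] := multi_partial_innermost br.
by rewrite E; apply: H => //; exact: test_function_partial.
Qed.

Lemma weak_derivativeP u r alpha :
  sobolev Omega r u -> (multi_order alpha <= r)%N ->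
  L2 Omega (weak_derivative Omega alpha u) /\
  is_weak_derivative Omega alpha u (weak_derivative Omega alpha u).
Proof. by move=> [_ H] ar; have := xgetPex (fun=> 0) (H alpha ar). Qed.

(** [weak_derivative] is an arbitrary choice among the weak derivatives, so it
    is not enough that 0 is one of them: the chosen one is zero almost
    everywhere by the fundamental lemma. *)
Lemma seminorm_eq0_of_derivatives_vanish u r :
  sobolev Omega r u -> derivatives_vanish u r ->
  sobolev_seminorm Omega r u = 0.
Proof.
move=> Su H; rewrite /sobolev_seminorm big1 ?sqrtr0// => alpha /eqP ar.
have [L2g wg] := @weak_derivativeP u r (fun i => alpha i) Su (eq_leq ar).
set g := weak_derivative _ _ _ in L2g wg *.
have g0 : ae_eq leb Omega (EFin \o g) (cst 0%E).
  apply: fundamental_lemma => // phi tphi.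
  have := wg phi tphi; rewrite (H _ ar _ tphi) => /esym/eqP.
  by rewrite mulf_eq0 signr_eq0 => /eqP.
have mg := L2g.1.
under eq_Rintegral do rewrite expr2.
exact: ae_eq0_Rintegral_mul.
Qed.

Lemma derivatives_vanish_of_seminorm_eq0 u r : sobolev Omega r u ->
  sobolev_seminorm Omega r u = 0 -> derivatives_vanish u r.
Proof.
move=> Su; rewrite /sobolev_seminorm; set S := (X in Num.sqrt X).
have Sge0 (f : {ffun 'I_n -> 'I_r.+1}) : 0 <=
    \int[leb]_(x in Omega) (weak_derivative Omega (fun i => f i) u x ^+ 2).
  by apply: Rintegral_ge0 => x _; exact: sqr_ge0.
move=> /eqP; rewrite sqrtr_eq0 => S0.
have {}S0 : S = 0 by apply/eqP; rewrite eq_le S0 sumr_ge0.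
move=> alpha ar phi tphi.
have ale i : (alpha i < r.+1)%N.
  by rewrite ltnS -ar /multi_order (bigD1 i)//= leq_addr.
pose f : {ffun 'I_n -> 'I_r.+1} := [ffun i => Ordinal (ale i)].
have fE : (fun i => nat_of_ord (f i)) = alpha.
  by apply/funext => i; rewrite ffunE.
have /psumr_eq0P := S0 => /(_ (fun f _ => Sge0 f) f).
rewrite fE ar eqxx => /(_ isT) g20.
have [L2g wg] := weak_derivativeP Su (eq_leq ar).
rewrite wg// (@ae_eq0_Rintegral_mul (weak_derivative Omega alpha u)) ?mulr0//.
- exact: L2g.1.
- exact: measurable_test_function.
- exact: L2_sqr_eq0.
Qed.

(** Vanishing passes to higher orders on the side of the test functions, where
    differentiation is unrestricted. *)
Lemma sobolev_seminorm_eq0_le u r s :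
  (r <= s)%N -> (forall m, sobolev Omega m u) ->
  sobolev_seminorm Omega r u = 0 -> sobolev_seminorm Omega s u = 0.
Proof.
move=> rs Su u0; apply: seminorm_eq0_of_derivatives_vanish => //.
elim: s rs => [|s IH].
  by rewrite leqn0 => /eqP <-; exact: derivatives_vanish_of_seminorm_eq0.
rewrite leq_eqVlt => /predU1P[<-|].
  exact: derivatives_vanish_of_seminorm_eq0.
by move=> /IH; exact: derivatives_vanishS.
Qed.
End sobolev_seminorms.

(** * Conclusion *)

Lemma diam_ge0 (R : realType) (n : nat) (A : set 'rV[R]_n) : 0 <= diam A.
Proof.
rewrite /diam; set S := [set d | _].
have [supS|/sup_out -> //] := pselect (has_sup S).
have [d Sd] := supS.1; apply: le_trans (sup_upper_bound supS Sd).
by have [x [y [_ _ ->]]] := Sd; exact: sqrtr_ge0.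
Qed.

(** The constant cancels in h*_q, but only because it is not zero. *)
Lemma C_geom_gt0 (R : realType) (n N : nat) (Omega : set 'rV[R]_n)
    (T : 'I_N -> 'M[R]_(n.+1, n)) (sigma : R) :
  0 <= sigma -> 0 < C_geom Omega sigma (mesh_Lambda T).
Proof.
move=> sigma0; rewrite /C_geom -addrA ltr_pwDl// addr_ge0//.
  by rewrite mulr_ge0// diam_ge0.
by rewrite !mulr_ge0// bigmax_ge_id.
Qed.

(** As soon as h*_q >= 2 h, the distance to 1 is at most 2 ^ - (q + 1). *)
Lemma cvg_P_fun (R : realType) (hs : nat -> R) (h : R) : 0 < h ->
  hs @ \oo --> +oo -> (fun q => P_fun (hs q) q h) @ \oo --> (1 : R).
Proof.
move=> h0 /cvgryPge hsoo.
have half0 : (fun q : nat => (2^-1 : R) ^+ q) @ \oo --> (0 : R).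
  by apply: cvg_expr; rewrite ger0_norm// invf_lt1// ltr1n.
have lb : (fun q : nat => 1 - 2^-1 * (2^-1 : R) ^+ q) @ \oo --> (1 : R).
  suff : (fun q : nat => 1 - 2^-1 * (2^-1 : R) ^+ q) @ \oo
      --> (1 - 2^-1 * 0 : R).
    by rewrite mulr0 subr0.
  apply: cvgB; first exact: cvg_cst.
  by apply: cvgM; first exact: cvg_cst.
apply: (@squeeze_cvgr _ _ _ _ (fun q : nat => 1 - 2^-1 * 2^-1 ^+ q) (cst 1));
  [|exact: lb|exact: cvg_cst].
near=> q.
have hsq : 2 * h <= hs q by near: q; exact: hsoo.
have hs0 : 0 < hs q by rewrite (lt_le_trans _ hsq)// mulr_gt0.
have hhalf : h / hs q <= 2^-1 by rewrite ler_pdivrMr//; lra.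
have hh0 : 0 <= h / hs q by rewrite divr_ge0// ltW.
rewrite /P_fun ifT; last by rewrite (le_trans hhalf)// invf_le1// ler1n.
have := exprn_ge0 q hh0.
have : (h / hs q) ^+ q <= 2^-1 ^+ q by rewrite lerXn2r// nnegrE.
move: ((h / hs q) ^+ q) (2^-1 ^+ q) => x y xy x0.
by apply/andP; rewrite /=; lra.
Unshelve. all: by end_near. Qed.

Theorem theorem4p2 (R : realType) (n : nat) (n_gt0 : (0 < n)%N)
    (Omega : set 'rV[R]_n)
    (Omega_nonempty : Omega !=set0)
    (Omega_bounded : bounded_set Omega)
    (Omega_open : open Omega)
    (Omega_boundary : piecewise_C1_boundary Omega)
    (N : nat) (T : 'I_N -> 'M[R]_(n.+1, n)) (sigma : R)
    (T_mesh : simplicial_mesh Omega T)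
    (sigma_ge1 : 1 <= sigma)
    (T_regular : regular_mesh sigma T)
    (a : ('rV[R]_n -> R) -> ('rV[R]_n -> R) -> R) (M alpha : R)
    (a_bilinear : bilinear_form Omega a)
    (a_continuous : continuous_bilinear_form Omega M a)
    (a_elliptic : elliptic_form Omega alpha a)
    (ell : ('rV[R]_n -> R) -> R)
    (ell_linear : linear_form Omega ell)
    (ell_continuous : continuous_linear_form Omega ell)
    (u : 'rV[R]_n -> R)
    (u_solution : solves_VP Omega a ell u)
    (u_regular : forall r : nat, sobolev Omega r u)
    (k : nat) (k_gt : n%:R / 2 < k%:R :> R)
    (l : R) (l_gt0 : 0 < l)
    (u_ratio : (fun q : nat => sobolev_seminorm Omega (k + q + 2) u /
                               sobolev_seminorm Omega (k + q + 1) u)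
               @ \oo --> l) :
  let C := C_geom Omega sigma (mesh_Lambda T) in
  let hs := h_star Omega u M alpha C k in
  [/\ (fun q : nat => hs q / (1 / (expR 1 * l) * q%:R)) @ \oo --> (1 : R),
      hs @ \oo --> +oo &
      forall h : R, 0 < h ->
        (fun q : nat => P_fun (hs q) q h) @ \oo --> P_zero h%:E].
Proof.
move=> C hs.
have M_gt0 := a_continuous.1; have alpha_gt0 := a_elliptic.1.
have C_gt0 : 0 < C by apply: C_geom_gt0; rewrite (le_trans ler01).
pose s q := sobolev_seminorm Omega (k + q + 1) u.
have s_gt0 q : 0 < s q.
  rewrite lt0r sqrtr_ge0 andbT; apply/eqP => sq0.
  suff : (0 : R) = l by move=> l0; move: l_gt0; rewrite -l0 ltxx.
  apply/esym; apply: (cvg_unique _ u_ratio) => //.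
  apply: cvg_near_cst; near=> p.
  have qp : (q <= p)%N by near: p; exists q.
  rewrite -/(s p) (_ : s p = 0) ?invr0 ?mulr0//.
  apply: (@sobolev_seminorm_eq0_le _ _ _ Omega_open _ (k + q + 1)%N) => //.
  by rewrite !leq_add2r leq_add2l.
have s_ratio : (fun q => s q.+1 / s q) @ \oo --> l.
  apply: cvgn_ext u_ratio => q; rewrite /s.
  by have -> : (k + q + 2 = k + q.+1 + 1)%N by rewrite addn2 addn1 addnS.
have hs_equiv : (fun q => hs q / (1 / (expR 1 * l) * q%:R)) @ \oo --> (1 : R).
  have := h_star_asymptotics n_gt0 M_gt0 alpha_gt0 C_gt0
    k_gt s_gt0 l_gt0 s_ratio.
  by rewrite {1}/s addn0.
have hs_oo : hs @ \oo --> +oo.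
  have el0 : 0 < expR 1 * l by rewrite mulr_gt0 ?expR_gt0.
  apply/cvgryPge => A; near=> q.
  have q0 : 0 < q%:R :> R by rewrite ltr0n; near: q; exists 1%N.
  have D0 : 0 < 1 / (expR 1 * l) * q%:R by rewrite mulr_gt0 ?divr_gt0.
  have : 2^-1 <= hs q / (1 / (expR 1 * l) * q%:R).
    near: q; apply: (cvgr_ge _ hs_equiv).
    by rewrite invf_lt1// ltr1n.
  rewrite ler_pdivlMr//; apply: le_trans.
  rewrite mul1r mulrA -invfM ler_pdivlMl ?mulr_gt0//.
  by near: q; exact: nbhs_infty_ger.
split => // h h0; rewrite /P_zero/=.
exact: cvg_P_fun.
Unshelve. all: by end_near. Qed.
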